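(* The linear operator $\mathcal T:\mathbb{R}^{\mathbf V^{\mathrm{st}}}\times(\mathbb{R}^{3\times\mathbf T^{\mathrm{st}}})^6\times\mathbb{R}^{\mathbf V^{\mathrm{st}}}\to\prod_{(k,\bm v)\in\mathbf V^{\mathrm{st}}}\mathbb{R}^{2+6|T_{\bm v}|}$ defined in the context satisfies $\mathcal T=\mathcal P\mathcal D$ and $\mathcal T^{-1}=\mathcal D^{-1}\mathcal P^*$, with $\mathcal D$ being diagonal and $\mathcal P$ being a permutation matrix, where $$\mathcal D:=\mathrm{Diag}\big(\mathcal I_{|\mathbf V^{\mathrm{st}}|},\ \mathcal I_2\otimes\mathrm{Diag}(\mathcal D_1,\mathcal D_2,\mathcal D_3),\ \mathcal I_{|\mathbf V^{\mathrm{st}}|}\big),$$ $$\mathcal P:=\big(\mathcal P^{\frac12,\bm v_1};\dots;\mathcal P^{\frac12,\bm v_{|V|}};\mathcal P^{\frac32,\bm v_1};\dots;\mathcal P^{\frac32,\bm v_{|V|}};\dots;\mathcal P^{N-\frac12,\bm v_{|V|}}\big),$$ $$\mathcal P^{k,\bm v}:=\mathrm{Diag}\big(\bm e_{k,\bm v}^\top,\mathcal P_1^{k,\bm v},\mathcal P_2^{k,\bm v},\mathcal P_3^{k,\bm v},\mathcal P_1^{k,\bm v},\mathcal P_2^{k,\bm v},\mathcal P_3^{k,\bm v},\bm e_{k,\bm v}^\top\big).$$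
   Context: $V=\{\bm v_1,\dots,\bm v_{|V|}\}\subset\mathbb{R}^3$ and $T=\{\bm f_1,\dots,\bm f_{|T|}\}$ are the finite sets of vertices and (nondegenerate, closed) triangles of a triangular mesh; $N\ge1$ is an integer. $T_{\bm v}$ is the set of triangles having $\bm v$ as a vertex, $|\bm f|$ the area of $\bm f$, $|\bm v|:=\frac13\sum_{\bm f\in T_{\bm v}}|\bm f|$. For each $\bm f\in T$ an ordering $\bm v_1^{\bm f},\bm v_2^{\bm f},\bm v_3^{\bm f}$ of its three vertices is fixed, and $T_{\bm v,i}:=\{\bm f\in T_{\bm v}\mid\bm v_i^{\bm f}=\bm v\}$ for $i=1,2,3$, with elements listed in order as $\bm f_1^{\bm v,i},\dots,\bm f_{|T_{\bm v,i}|}^{\bm v,i}$. $\mathcal G^{\mathrm{st}}=\{\frac12,\frac32,\dots,N-\frac12\}$, $\mathbf V^{\mathrm{st}}=\mathcal G^{\mathrm{st}}\times V$, $\mathbf T^{\mathrm{st}}=\mathcal G^{\mathrm{st}}\times T$, ordered lexicographically with time first. $\mathbb{R}^{3\times\mathbf T^{\mathrm{st}}}$ is the space of families $(\bm D_{k,\bm f})$ of vectors in $\mathbb{R}^3$ indexed by $\mathbf T^{\mathrm{st}}$, identified with $\mathbb{R}^{3|\mathbf T^{\mathrm{st}}|}$. $\mathcal I_n$ is the identity matrix, $\otimes$ the Kronecker product, $\mathrm{Diag}$ denotes a block-diagonal matrix with (possibly rectangular) blocks, $(\cdot;\cdot)$ vertical stacking, $(\cdot)^*$ the Euclidean adjoint,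 and $\bm e_{k,\bm v}\in\mathbb{R}^{\mathbf V^{\mathrm{st}}}$ the unit vector associated with $(k,\bm v)$. For $i=1,2,3$: $$\mathcal D_i:=\mathcal I_{|\mathcal G^{\mathrm{st}}|}\otimes\mathrm{Diag}\Big(\sqrt{|\bm f_1|/|\bm v_i^{\bm f_1}|},\dots,\sqrt{|\bm f_{|T|}|/|\bm v_i^{\bm f_{|T|}}|}\Big)\otimes\mathcal I_3\ \text{ on }\mathbb{R}^{3\times\mathbf T^{\mathrm{st}}},$$ and for $(k,\bm v)\in\mathbf V^{\mathrm{st}}$ the maps $\mathcal P_i^{k,\bm v},\mathcal T_i^{k,\bm v}:\mathbb{R}^{3\times\mathbf T^{\mathrm{st}}}\to\mathbb{R}^{3|T_{\bm v,i}|}$ are $$\mathcal P_i^{k,\bm v}\bm D:=\big(\bm D_{k,\bm f_1^{\bm v,i}};\dots;\bm D_{k,\bm f_{|T_{\bm v,i}|}^{\bm v,i}}\big),\qquad \mathcal T_i^{k,\bm v}\bm D:=\Big(\sqrt{\tfrac{|\bm f_1^{\bm v,i}|}{|\bm v|}}\,\bm D_{k,\bm f_1^{\bm v,i}};\dots;\sqrt{\tfrac{|\bm f_{|T_{\bm v,i}|}^{\bm v,i}|}{|\bm v|}}\,\bm D_{k,\bm f_{|T_{\bm v,i}|}^{\bm v,i}}\Big)=\mathcal P_i^{k,\bm v}\mathcal D_i\bm D.$$ Then $\mathcal T^{k,\bm v}:=\mathrm{Diag}\big(\bm e_{k,\bm v}^\top,\mathcal T_1^{k,\bm v},\mathcal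 T_2^{k,\bm v},\mathcal T_3^{k,\bm v},\mathcal T_1^{k,\bm v},\mathcal T_2^{k,\bm v},\mathcal T_3^{k,\bm v},\bm e_{k,\bm v}^\top\big)$, mapping $\mathbb{R}^{\mathbf V^{\mathrm{st}}}\times(\mathbb{R}^{3\times\mathbf T^{\mathrm{st}}})^6\times\mathbb{R}^{\mathbf V^{\mathrm{st}}}$ to $\mathbb{R}^{2+6|T_{\bm v}|}$, and $$\mathcal T\bm z:=\big(\mathcal T^{\frac12,\bm v_1}\bm z;\dots;\mathcal T^{\frac12,\bm v_{|V|}}\bm z;\mathcal T^{\frac32,\bm v_1}\bm z;\dots;\mathcal T^{\frac32,\bm v_{|V|}}\bm z;\dots;\mathcal T^{N-\frac12,\bm v_{|V|}}\bm z\big).$$ *)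

(* Defs.v *)
From HB Require Import structures.
From mathcomp Require Import all_boot all_order all_algebra.
From mathcomp Require Export mxtens.
From mathcomp Require Import classical_sets reals.

Set Implicit Arguments.
Unset Strict Implicit.
Unset Printing Implicit Defensive.

Import Order.TTheory GRing.Theory Num.Theory.
Local Open Scope ring_scope.

Section Geometry.
Variable R : realType.
Implicit Types u w : 'rV[R]_3.

Definition euclid_norm u : R := Num.sqrt (\sum_(i < 3) u 0 i ^+ 2).

Definition cross u w : 'rV[R]_3 :=
  \row_(i < 3) (u 0 (i + 1) * w 0 (i + 2) - u 0 (i + 2) * w 0 (i + 1)).

Definition triangle_area (x : 'I_3 -> 'rV[R]_3) : R :=
  2^-1 * euclid_norm (cross (x 1 - x 0) (x 2 - x 0)).

Definition closed_triangle (x : 'I_3 -> 'rV[R]_3) : set 'rV[R]_3 :=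
  [set p | exists w : 'I_3 -> R,
     [/\ forall i, 0 <= w i, \sum_i w i = 1 & p = \sum_i w i *: x i]]%classic.

Definition nondegenerate (x : 'I_3 -> 'rV[R]_3) : Prop :=
  row_free (col_mx (x 1 - x 0) (x 2 - x 0)).

End Geometry.

(* [tri f i] is the index of the i-th vertex of the triangle f in the chosen
   ordering of its three vertices; i : 'I_3 is numbered from 0. *)
Record mesh (R : realType) (nV nT : nat) := Mesh {
  vtx : 'I_nV -> 'rV[R]_3;
  vtx_inj : injective vtx;
  tri : 'I_nT -> 'I_3 -> 'I_nV;
  tri_nondegenerate : forall f, nondegenerate (vtx \o tri f);
  tri_inj : injective (fun f => closed_triangle (vtx \o tri f))
}.

Section BlockDiag.
Variable R : pzRingType.

Definition diag2 m1 m2 n1 n2 (A : 'M[R]_(m1, n1)) (B : 'M[R]_(m2, n2)) :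
  'M[R]_(m1 + m2, n1 + n2) := block_mx A 0 0 B.

Definition diag3 m1 m2 m3 n1 n2 n3 (A : 'M[R]_(m1, n1)) (B : 'M[R]_(m2, n2))
    (C : 'M[R]_(m3, n3)) : 'M[R]_(m1 + (m2 + m3), n1 + (n2 + n3)) :=
  diag2 A (diag2 B C).

End BlockDiag.

Lemma two_muln (m : nat) : (2 * m = m + m)%N.
Proof. by rewrite mul2n addnn. Qed.

Section Operators.
Variables (R : realType) (N nV nT : nat) (M : mesh R nV nT).
Implicit Types (i : 'I_3) (k : 'I_N) (v : 'I_nV) (f : 'I_nT).

Definition area f : R := triangle_area (vtx M \o tri M f).

Definition tris_at v : {set 'I_nT} := [set f | [exists i, tri M f i == v]].

Definition tris_at_i v i : {set 'I_nT} := [set f in tris_at v | tri M f i == v].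

Definition vtx_area v : R := 3^-1 * \sum_(f in tris_at v) area f.

(* k : 'I_N stands for the time k + 1/2.  The coordinate (k, v) of R^Vst is
   numbered mxtens_index (k, v) = k * nV + v, and the coordinate c of the
   component (k, f) of R^(3 x Tst) is numbered (k * nT + f) * 3 + c. *)
Definition dimV := (N * nV)%N.
Definition dimT := (N * nT * 3)%N.

Definition unitv k v : 'cV[R]_dimV := delta_mx (mxtens_index (k, v)) 0.

(* The matrix of D |-> D_{k,f}. *)
Definition component k f : 'M[R]_(3, dimT) :=
  rowsub (fun c => mxtens_index (mxtens_index (k, f), c)) 1%:M.

(* [enum_val] lists the elements of tris_at_i v i in increasing order. *)
Definition P_i i k v : 'M[R]_(\sum_(j < #|tris_at_i v i|) 3, dimT) :=
  \mxcol_(j < #|tris_at_i v i|) component k (enum_val j).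

Definition T_i i k v : 'M[R]_(\sum_(j < #|tris_at_i v i|) 3, dimT) :=
  \mxcol_(j < #|tris_at_i v i|)
    (Num.sqrt (area (enum_val j) / vtx_area v) *: component k (enum_val j)).

Definition D_i i : 'M[R]_dimT :=
  (1%:M : 'M[R]_N)
    *t diag_mx (\row_(f < nT) Num.sqrt (area f / vtx_area (tri M f i)))
    *t (1%:M : 'M[R]_3).

(* R^Vst x (R^(3 x Tst))^6 x R^Vst, and the target space of the block (k, v). *)
Definition dim_dom : nat :=
  let half := (dimT + (dimT + dimT))%N in (dimV + ((half + half) + dimV))%N.

Definition dim_blk v : nat :=
  let half := ((\sum_(j < #|tris_at_i v 0%R|) 3) +
               ((\sum_(j < #|tris_at_i v 1%R|) 3) +
                (\sum_(j < #|tris_at_i v 2%R|) 3)))%N in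
  (1 + ((half + half) + 1))%N.

Definition T_blk k v : 'M[R]_(dim_blk v, dim_dom) :=
  let H := diag3 (T_i 0 k v) (T_i 1 k v) (T_i 2 k v) in
  diag3 (unitv k v)^T (diag2 H H) (unitv k v)^T.

Definition P_blk k v : 'M[R]_(dim_blk v, dim_dom) :=
  let H := diag3 (P_i 0 k v) (P_i 1 k v) (P_i 2 k v) in
  diag3 (unitv k v)^T (diag2 H H) (unitv k v)^T.

Definition blk_time (b : 'I_(N * nV)) : 'I_N := (mxtens_unindex b).1.
Definition blk_vtx (b : 'I_(N * nV)) : 'I_nV := (mxtens_unindex b).2.

Definition dim_cod : nat := (\sum_(b < N * nV) dim_blk (blk_vtx b))%N.

Definition opT : 'M[R]_(dim_cod, dim_dom) :=
  \mxcol_(b < N * nV) T_blk (blk_time b) (blk_vtx b).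

Definition opP : 'M[R]_(dim_cod, dim_dom) :=
  \mxcol_(b < N * nV) P_blk (blk_time b) (blk_vtx b).

Definition opD : 'M[R]_dim_dom :=
  let H := diag3 (D_i 0) (D_i 1) (D_i 2) in
  diag3 (1%:M : 'M[R]_dimV)
    (castmx (two_muln _, two_muln _) ((1%:M : 'M[R]_2) *t H))
    (1%:M : 'M[R]_dimV).

End Operators.

Arguments dim_cod {R} N {nV nT} M.
Arguments opT {R} N {nV nT} M.
Arguments opP {R} N {nV nT} M.
Arguments opD {R} N {nV nT} M.

(* Main.v *)
Require Import Defs.
From mathcomp Require Import all_boot all_order all_algebra.
From mathcomp Require Import reals.
From mathcomp Require Import fingroup perm.

(** The operator [opT] reads off, for every pair (k, v), the coordinates of its
    argument attached to that pair, each multiplied by a weight that depends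
    only on the coordinate read.  Indeed, if f has v as its i-th vertex, the
    weight sqrt (|f| / |v|) is the one that the i-th diagonal operator attaches
    to f.  Rescaling first and reading afterwards is therefore the same:
    [opT_factor].

    The weights are positive, because the triangles are nondegenerate; so the
    diagonal factor [opD] is invertible ([opD_unit]).

    The reading operator [opP] is a permutation because every coordinate is
    read exactly once.  Both halves of this are stated without naming the
    permutation, whose explicit form would mix enumerations of triangles with
    nested block offsets.  Every row of [opP] is a unit vector
    ([unit_rows_opP]), which is stable under stacking and block-diagonal sums;
    and the Gram matrix of the columns is the identity ([gram_opP]), because it
    is a sum over (k, v) of block-diagonal matrices, and for fixed i each
    triangle f has exactly one i-th vertex v.  These two facts determine the
    rest ([unit_rows_perm]): comparing the traces of A^T A and A A^T shows that
    the matrix is square, then A A^T = 1 shows that no two rows coincide.  In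
    particular the equality of the dimensions of the two spaces comes out of
    the trace identity, not out of a count of coordinates.

    The formula for the inverse is then that of a product, with P^-1 = P^T.
    The only place that needs a count is the size of a block, 2 + 6 |T_v|:
    the three vertices of a triangle are distinct ([nondegenerate_inj]), so
    the sets of triangles having v as first, second and third vertex are
    disjoint ([card_tris_at]). *)

Import Order.TTheory GRing.Theory Num.Theory.
Local Open Scope ring_scope.

Set Implicit Arguments.
Unset Strict Implicit.

(** * Permutation matrices *)

Definition unit_rows (R : pzSemiRingType) m n (A : 'M[R]_(m, n)) : Prop :=
  forall r, exists c, row r A = delta_mx 0 c.

(** The entries of A A^T compare rows, so its trace counts the rows, while the
    trace of A^T A = 1 counts the columns; characteristic 0 turns the equality
    of traces into m = n.  Then A A^T = 1 as well, so the map sending a row to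
    the position of its 1 is injective. *)
Lemma unit_rows_perm (R : numDomainType) m n (A : 'M[R]_(m, n)) :
  unit_rows A -> A^T *m A = 1%:M ->
  exists e : m = n, is_perm_mx (castmx (e, erefl) A).
Proof.
move=> /fin_all_exists[g Ag].
have AE : A = rowsub g 1%:M.
  by apply/row_matrixP => i; rewrite Ag row_rowsub row1.
have gramE i j : (A *m A^T) i j = (g j == g i)%:R.
  by rewrite {1}AE mul_rowsub_mx mul1mx AE !mxE.
move=> AtA; have e : m = n.
  apply/eqP; rewrite -(eqr_nat R) -(mxtrace1 R n) -AtA mxtrace_mulC.
  rewrite /mxtrace (eq_bigr (fun=> 1)) => [|i _]; last by rewrite gramE eqxx.
  by rewrite sumr_const card_ord.
exists e; case: n / e A g {Ag} AE gramE AtA => A g AE gramE AtA.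
have g_inj : injective g.
  move=> i j gij; move: (gramE i j).
  rewrite gij eqxx (mulmx1C AtA) mxE; case: eqP => // _ /eqP.
  by rewrite eq_sym oner_eq0.
rewrite castmx_id; apply/is_perm_mxP; exists (perm g_inj).
by rewrite perm_mxEsub AE; apply/matrixP => i j; rewrite !mxE permE.
Qed.

Lemma unit_rows_diag2 (R : pzRingType) m1 m2 n1 n2
    (A : 'M[R]_(m1, n1)) (B : 'M[R]_(m2, n2)) :
  unit_rows A -> unit_rows B -> unit_rows (diag2 A B).
Proof.
move=> uA uB r; rewrite /diag2 /block_mx.
case: (split_ordP r) => i ->.
  have [c Ac] := uA i; exists (lshift n2 c).
  by rewrite rowKu row_row_mx Ac row0 -delta_mx_lshift.
have [c Bc] := uB i; exists (rshift n1 c).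
by rewrite rowKd row_row_mx Bc row0 -delta_mx_rshift.
Qed.

Lemma unit_rows_diag3 (R : pzRingType) m1 m2 m3 n1 n2 n3
    (A : 'M[R]_(m1, n1)) (B : 'M[R]_(m2, n2)) (C : 'M[R]_(m3, n3)) :
  unit_rows A -> unit_rows B -> unit_rows C -> unit_rows (diag3 A B C).
Proof. by move=> uA uB uC; do 2![apply: unit_rows_diag2 => //]. Qed.

Lemma unit_rows_mxcol (R : pzRingType) p (p_ : 'I_p -> nat) n
    (B : forall i, 'M[R]_(p_ i, n)) :
  (forall i, unit_rows (B i)) -> unit_rows (\mxcol_i B i).
Proof. by move=> uB r; rewrite row_mxcol; apply: uB. Qed.

Lemma unit_rows_rowsub (R : pzRingType) m n (g : 'I_m -> 'I_n) :
  unit_rows (rowsub g (1%:M : 'M[R]_n)).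
Proof. by move=> r; exists (g r); rewrite row_rowsub row1. Qed.

Lemma perm_mx_tr_mul (R : pzRingType) n (P : 'M[R]_n) :
  is_perm_mx P -> P *m P^T = 1%:M.
Proof.
by case/is_perm_mxP => s ->; rewrite tr_perm_mx -perm_mxM mulgV perm_mx1.
Qed.

Lemma perm_mul_unit_inv (R : comUnitRingType) m n (e : m = n)
    (P : 'M[R]_(m, n)) (D : 'M[R]_n) :
  is_perm_mx (castmx (e, erefl) P) -> D \in unitmx ->
  castmx (e, erefl) (P *m D) \in unitmx /\
  invmx (castmx (e, erefl) (P *m D)) = invmx D *m (castmx (e, erefl) P)^T.
Proof.
case: n / e P D => P D; rewrite !castmx_id => /perm_mx_tr_mul PPt uD.
have [uP _] := mulmx1_unit PPt.
have uPD : P *m D \in unitmx by rewrite unitmx_mul uP.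
split=> //; apply: (can_inj (mulKmx uPD)).
by rewrite mulmxV // -mulmxA mulKVmx.
Qed.

(** * Block-diagonal matrices *)

Lemma sum_mxtens_index (V : nmodType) m n (F : 'I_(m * n) -> V) :
  \sum_b F b = \sum_i \sum_j F (mxtens_index (i, j)).
Proof.
rewrite pair_big; rewrite (reindex (@mxtens_index m n)) /=.
  by apply: eq_bigr => -[].
exists (@mxtens_unindex m n) => x _; [exact: mxtens_indexK|].
exact: mxtens_unindexK.
Qed.

Section BlockDiagonal.
Variable R : pzRingType.

Lemma mul_diag2 m1 m2 n1 n2 p1 p2 (A : 'M[R]_(m1, n1)) (B : 'M[R]_(m2, n2))
    (C : 'M[R]_(n1, p1)) (D : 'M[R]_(n2, p2)) :
  diag2 A B *m diag2 C D = diag2 (A *m C) (B *m D).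
Proof. by rewrite mulmx_block !mul0mx !mulmx0 !addr0 add0r. Qed.

Lemma mul_diag3 m1 m2 m3 n1 n2 n3 p1 p2 p3
    (A : 'M[R]_(m1, n1)) (B : 'M[R]_(m2, n2)) (C : 'M[R]_(m3, n3))
    (A' : 'M[R]_(n1, p1)) (B' : 'M[R]_(n2, p2)) (C' : 'M[R]_(n3, p3)) :
  diag3 A B C *m diag3 A' B' C' = diag3 (A *m A') (B *m B') (C *m C').
Proof. by rewrite /diag3 !mul_diag2. Qed.

Lemma tr_diag2 m1 m2 n1 n2 (A : 'M[R]_(m1, n1)) (B : 'M[R]_(m2, n2)) :
  (diag2 A B)^T = diag2 A^T B^T.
Proof. by rewrite /diag2 tr_block_mx !trmx0. Qed.

Lemma tr_diag3 m1 m2 m3 n1 n2 n3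
    (A : 'M[R]_(m1, n1)) (B : 'M[R]_(m2, n2)) (C : 'M[R]_(m3, n3)) :
  (diag3 A B C)^T = diag3 A^T B^T C^T.
Proof. by rewrite /diag3 !tr_diag2. Qed.

Lemma sum_diag2 (I : finType) m1 m2 n1 n2
    (A : I -> 'M[R]_(m1, n1)) (B : I -> 'M[R]_(m2, n2)) :
  \sum_i diag2 (A i) (B i) = diag2 (\sum_i A i) (\sum_i B i).
Proof.
elim/big_ind3: _ => [|A1 A2 B1 B2 D1 D2 -> ->|//].
  by rewrite /diag2 block_mx0.
by rewrite /diag2 add_block_mx !addr0.
Qed.

Lemma sum_diag3 (I : finType) m1 m2 m3 n1 n2 n3
    (A : I -> 'M[R]_(m1, n1)) (B : I -> 'M[R]_(m2, n2))
    (C : I -> 'M[R]_(m3, n3)) :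
  \sum_i diag3 (A i) (B i) (C i) =
    diag3 (\sum_i A i) (\sum_i B i) (\sum_i C i).
Proof. by rewrite /diag3 !sum_diag2. Qed.

Lemma diag2_1 m n : diag2 (1%:M : 'M[R]_m) (1%:M : 'M[R]_n) = 1%:M.
Proof. by rewrite [RHS]scalar_mx_block. Qed.

Lemma diag3_1 m n p :
  diag3 (1%:M : 'M[R]_m) (1%:M : 'M[R]_n) (1%:M : 'M[R]_p) = 1%:M.
Proof. by rewrite /diag3 !diag2_1. Qed.

Lemma diag2_is_diag m n (A : 'M[R]_m) (B : 'M[R]_n) :
  is_diag_mx A -> is_diag_mx B -> is_diag_mx (diag2 A B).
Proof. by move=> dA dB; rewrite is_diag_block_mx // !eqxx dA. Qed.

Lemma diag3_is_diag m n p (A : 'M[R]_m) (B : 'M[R]_n) (C : 'M[R]_p) :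
  is_diag_mx A -> is_diag_mx B -> is_diag_mx C -> is_diag_mx (diag3 A B C).
Proof. by move=> dA dB dC; do 2![apply: diag2_is_diag => //]. Qed.

(** The left tensor factor indexes the blocks: coordinate (b, i) is numbered
    b * n + i, which is where the b-th summand of [diag2] puts i. *)
Lemma tens1_2 n (H : 'M[R]_n) :
  castmx (two_muln n, two_muln n) ((1%:M : 'M[R]_2) *t H) = diag2 H H.
Proof.
have castl (i : 'I_n) :
    cast_ord (esym (two_muln n)) (lshift n i) = mxtens_index (0 : 'I_2, i).
  by apply: val_inj; rewrite /= mul0n.
have castr (i : 'I_n) :
    cast_ord (esym (two_muln n)) (rshift n i) = mxtens_index (1 : 'I_2, i).
  by apply: val_inj; rewrite /= mul1n.
apply/matrixP => i j; rewrite castmxE /diag2.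
by case: (split_ordP i) => i' ->; case: (split_ordP j) => j' ->;
  rewrite ?castl ?castr tensmxE ?block_mxEul ?block_mxEur ?block_mxEdl
    ?block_mxEdr !mxE ?mul1r ?mul0r.
Qed.

Lemma tens_diag_mx m n (a : 'rV[R]_m) (b : 'rV[R]_n) :
  diag_mx a *t diag_mx b =
    diag_mx (\row_x (a 0 (mxtens_unindex x).1 * b 0 (mxtens_unindex x).2)).
Proof.
apply/matrixP => x y.
case: (mxtens_indexP x) => i j; case: (mxtens_indexP y) => i' j'.
rewrite tensmxE !mxE !mxtens_indexK /= (can_eq (@mxtens_indexK m n)) xpair_eqE.
by case: eqP => _; case: eqP => _; rewrite ?mulr1n ?mulr0n ?mul0r ?mulr0.
Qed.

End BlockDiagonal.

Lemma diag2_unit (R : comUnitRingType) m n (A : 'M[R]_m) (B : 'M[R]_n) :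
  A \in unitmx -> B \in unitmx -> diag2 A B \in unitmx.
Proof. by rewrite !unitmxE det_ublock unitrM => -> ->. Qed.

Lemma diag3_unit (R : comUnitRingType) m n p
    (A : 'M[R]_m) (B : 'M[R]_n) (C : 'M[R]_p) :
  A \in unitmx -> B \in unitmx -> C \in unitmx -> diag3 A B C \in unitmx.
Proof. by move=> uA uB uC; do 2![apply: diag2_unit => //]. Qed.

(** * Nondegenerate triangles *)

Section Triangles.
Variable R : realType.
Implicit Types u w : 'rV[R]_3.

Lemma ord3_ind (P : 'I_3 -> Prop) : P 0 -> P 1 -> P 2 -> forall i, P i.
Proof.
move=> P0 P1 P2 [[|[|[|//]]] lt].
- by rewrite (_ : Ordinal lt = 0) //; apply: val_inj.
- by rewrite (_ : Ordinal lt = 1) //; apply: val_inj.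
- by rewrite (_ : Ordinal lt = 2) //; apply: val_inj.
Qed.

(** The cross product lists the 2 x 2 minors of the matrix with rows u and w.
    When they all vanish, w_j u - u_j w = 0 for every j, a linear relation
    between u and w; freeness makes all its coefficients w_j and u_j vanish,
    and then u = w = 0. *)
Lemma cross_eq0_not_free u w :
  cross u w = 0 -> ~~ row_free (col_mx u w).
Proof.
move=> uw0; apply/negP => fr.
have minor i j : u 0 i * w 0 j = u 0 j * w 0 i.
  have c0 := congr1 (fun x : 'rV_3 => x 0 0) uw0.
  have c1 := congr1 (fun x : 'rV_3 => x 0 1) uw0.
  have c2 := congr1 (fun x : 'rV_3 => x 0 2) uw0.
  move: c0 c1 c2; rewrite !mxE => /eqP + /eqP + /eqP.
  rewrite !subr_eq0 => /eqP e0 /eqP e1 /eqP e2.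
  have s11 : 1 + 1 = 2 :> 'I_3 by apply: val_inj.
  have s12 : 1 + 2 = 0 :> 'I_3 by apply: val_inj.
  have s21 : 2 + 1 = 0 :> 'I_3 by apply: val_inj.
  have s22 : 2 + 2 = 1 :> 'I_3 by apply: val_inj.
  rewrite ?add0r ?s11 ?s12 ?s21 ?s22 in e0 e1 e2.
  by elim/ord3_ind: i; elim/ord3_ind: j.
have coef j : w 0 j = 0 /\ u 0 j = 0.
  have : row_mx (w 0 j)%:M (- u 0 j)%:M *m col_mx u w = 0 *m col_mx u w.
    apply/rowP => l; rewrite mul0mx mul_row_col !mul_scalar_mx !mxE mulNr.
    by rewrite mulrC minor mulrC subrr.
  move/(row_free_inj fr); rewrite -row_mx0 => /eq_row_mx[].
  move=> /matrixP/(_ 0 0); rewrite !mxE mulr1n => w0.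
  by move=> /matrixP/(_ 0 0); rewrite !mxE mulr1n => /eqP; rewrite oppr_eq0 => /eqP.
have : col_mx u w = 0.
  rewrite -col_mx0; congr col_mx; apply/rowP => j; rewrite [RHS]mxE.
    by case: (coef j).
  by case: (coef j).
by move=> uw; move: fr; rewrite uw /row_free mxrank0.
Qed.

Lemma euclid_norm_gt0 u : u != 0 -> 0 < euclid_norm u.
Proof.
move=> u0; rewrite sqrtr_gt0 lt_def sumr_ge0 ?andbT; last first.
  by move=> i _; apply: sqr_ge0.
apply: contra u0; rewrite psumr_eq0; last by move=> i _; apply: sqr_ge0.
move=> /allP u0; apply/eqP/rowP => i; apply/eqP.
by have := u0 i (mem_index_enum i); rewrite /= sqrf_eq0 mxE.
Qed.

Lemma triangle_area_gt0 (x : 'I_3 -> 'rV[R]_3) :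
  Defs.nondegenerate x -> 0 < triangle_area x.
Proof.
move=> nd; rewrite mulr_gt0 ?invr_gt0 ?ltr0n //; apply: euclid_norm_gt0.
by apply: contraL nd => /eqP /cross_eq0_not_free.
Qed.

(** If two vertices coincide, the two edges issued from the first vertex are
    equal or one of them is zero, and their cross product vanishes. *)
Lemma nondegenerate_inj (x : 'I_3 -> 'rV[R]_3) :
  Defs.nondegenerate x -> injective x.
Proof.
move=> nd; have ncross : cross (x 1 - x 0) (x 2 - x 0) <> 0.
  by move=> /cross_eq0_not_free /negP; apply; apply: nd.
have neq01 : x 0 <> x 1.
  by move=> e; apply: ncross; apply/rowP => i; rewrite e !mxE !subrr !mul0r subrr.
have neq02 : x 0 <> x 2.
  by move=> e; apply: ncross; apply/rowP => i; rewrite e !mxE !subrr !mulr0 subrr.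
have neq12 : x 1 <> x 2.
  by move=> e; apply: ncross; apply/rowP => i; rewrite e !mxE mulrC subrr.
by elim/ord3_ind => [||]; elim/ord3_ind => // /esym.
Qed.

End Triangles.

(** * Areas and incidences in a mesh *)

Section Operators.
Variables (R : realType) (N nV nT : nat) (M : mesh R nV nT).
Implicit Types (i : 'I_3) (k : 'I_N) (v : 'I_nV) (f : 'I_nT).

Lemma area_gt0 f : 0 < area M f.
Proof. by apply: triangle_area_gt0; apply: tri_nondegenerate. Qed.

Lemma tri_vertex_inj f : injective (tri M f).
Proof.
by move=> i j e; apply: (nondegenerate_inj (tri_nondegenerate M f)); rewrite /= e.
Qed.

Lemma mem_tris_at_i v i f : (f \in tris_at_i M v i) = (tri M f i == v).
Proof.
rewrite !inE andbC; case: eqP => //= e.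
by apply/existsP; exists i; rewrite e.
Qed.

Lemma vtx_area_gt0 f i : 0 < vtx_area M (tri M f i).
Proof.
rewrite mulr_gt0 ?invr_gt0 ?ltr0n // (bigD1 f) /=; last first.
  by rewrite inE; apply/existsP; exists i.
by rewrite ltr_wpDr ?area_gt0 // sumr_ge0 // => g _; apply/ltW/area_gt0.
Qed.

(** Both sides count the pairs (f, i) such that v is the i-th vertex of f: a
    triangle at v has v as a vertex for exactly one i. *)
Lemma card_tris_at v :
  #|tris_at M v| =
    (#|tris_at_i M v 0%R| + (#|tris_at_i M v 1%R| + #|tris_at_i M v 2%R|))%N.
Proof.
have -> : (#|tris_at_i M v 0%R| + (#|tris_at_i M v 1%R| + #|tris_at_i M v 2%R|))%N =
    (\sum_(i < 3) #|tris_at_i M v i|)%N.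
  by rewrite !big_ord_recl big_ord0 addn0 /=; congr (_ + (_ + _))%N;
    congr #|pred_of_set (tris_at_i M v _)|; apply: val_inj.
rewrite -sum1_card.
under [RHS]eq_bigr => i _.
  rewrite -sum1_card (eq_bigl _ _ (mem_tris_at_i v i)) big_mkcond; over.
rewrite exchange_big big_mkcond; apply: eq_bigr => f _.
rewrite inE -big_mkcond sum1_card; case: existsP => [[i /eqP fi]|no].
  rewrite (@eq_card1 _ i) // => j; rewrite !inE -fi.
  by apply/eqP/eqP => [/val_inj e|-> //]; apply: tri_vertex_inj e.
by rewrite eq_card0 // => j; apply/negP => fj; case: no; exists j.
Qed.

Lemma dim_blkE v : dim_blk M v = (2 + 6 * #|tris_at M v|)%N.
Proof.
rewrite /dim_blk /= !sum_nat_const !card_ord card_tris_at.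
by rewrite -!mulnDl addnn -muln2 -mulnA addnA addnAC mulnC.
Qed.

(** * The factorization of the operator *)

(** The tensor product of diagonal matrices is diagonal; the diagonal is
    described by its values since only these are used. *)
Lemma D_iE i : exists2 d : 'rV[R]_(dimT N nT),
  D_i N M i = diag_mx d &
  forall k f c, d 0 (mxtens_index (mxtens_index (k, f), c)) =
    Num.sqrt (area M f / vtx_area M (tri M f i)).
Proof.
eexists.
  by rewrite /D_i -!diag_const_mx !tens_diag_mx.
by move=> k f c; rewrite mxE !mxtens_indexK !mxE mulr1 mxtens_indexK mul1r.
Qed.

Lemma D_i_is_diag i : is_diag_mx (D_i N M i).
Proof. by have [d -> _] := D_iE i; apply: diag_mx_is_diag. Qed.

Lemma D_i_unit i : D_i N M i \in unitmx.
Proof.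
have [d -> dE] := D_iE i; rewrite unitmxE det_diag unitfE.
apply/prodf_neq0 => x _; case: (mxtens_indexP x) => y c.
case: (mxtens_indexP y) => k f; rewrite dE gt_eqF // sqrtr_gt0.
by rewrite divr_gt0 ?area_gt0 ?vtx_area_gt0.
Qed.

Lemma component_D_i i k f :
  component R k f *m D_i N M i =
    Num.sqrt (area M f / vtx_area M (tri M f i)) *: component R k f.
Proof.
have [d -> dE] := D_iE i; apply/matrixP => c x.
rewrite mul_mx_diag !mxE mulrC.
by case: eqP => [<-|_]; rewrite ?mulr0n ?mulr0 // dE.
Qed.

(** The weight of f in the i-th diagonal operator involves the area at the i-th
    vertex of f, which is v for every f listed in the block (k, v). *)
Lemma P_i_D_i i k v : P_i M i k v *m D_i N M i = T_i M i k v.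
Proof.
rewrite mxcol_mul; apply: eq_mxcol => j; rewrite component_D_i.
by have /[!mem_tris_at_i] /eqP -> := enum_valP j.
Qed.

Lemma opDE :
  opD N M = let H := diag3 (D_i N M 0) (D_i N M 1) (D_i N M 2) in
            diag3 1%:M (diag2 H H) 1%:M.
Proof. by rewrite /opD tens1_2. Qed.

Lemma opT_factor : opT N M = opP N M *m opD N M.
Proof.
rewrite opDE mxcol_mul; apply: eq_mxcol => b.
by rewrite mul_diag3 mul_diag2 mul_diag3 !P_i_D_i !mulmx1.
Qed.

Lemma opD_is_diag : is_diag_mx (opD N M).
Proof.
by rewrite opDE; do ![apply: diag3_is_diag | apply: diag2_is_diag];
  rewrite ?scalar_mx_is_diag ?D_i_is_diag.
Qed.

Lemma opD_unit : opD N M \in unitmx.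
Proof.
by rewrite opDE; do ![apply: diag3_unit | apply: diag2_unit];
  rewrite ?unitmx1 ?D_i_unit.
Qed.

(** * The reading operator is a permutation *)

Lemma unit_rows_opP : unit_rows (opP N M).
Proof.
have uP i k v : unit_rows (P_i M i k v).
  by apply: unit_rows_mxcol => j; apply: unit_rows_rowsub.
have uV k v : unit_rows (unitv R k v)^T.
  by move=> r; exists (mxtens_index (k, v)); rewrite trmx_delta ord1 row_id.
apply: unit_rows_mxcol => b.
by do ![apply: unit_rows_diag3 | apply: unit_rows_diag2].
Qed.

Lemma gram_component k f :
  (component R k f)^T *m component R k f =
    \sum_c (delta_mx (mxtens_index (mxtens_index (k, f), c))
                     (mxtens_index (mxtens_index (k, f), c)) : 'M[R]_(dimT N nT)).
Proof.
apply/matrixP => x y; rewrite mxE summxE; apply: eq_bigr => c _.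
by rewrite !mxE -natrM mulnb eq_sym [y == _]eq_sym.
Qed.

(** The sum runs over the triples (k, v, f) such that v is the i-th vertex of
    f.  Since f determines v, every pair (k, f) occurs exactly once and
    contributes the identity of its three coordinates. *)
Lemma gram_P_i i :
  \sum_(b < N * nV) (P_i M i (blk_time b) (blk_vtx b))^T
                      *m P_i M i (blk_time b) (blk_vtx b) = 1%:M.
Proof.
rewrite mx1_sum_delta sum_mxtens_index [RHS]sum_mxtens_index.
rewrite [RHS]sum_mxtens_index; apply: eq_bigr => k _.
rewrite [RHS](partition_big (fun f => tri M f i) xpredT) //=.
apply: eq_bigr => v _; rewrite /blk_time /blk_vtx mxtens_indexK /=.
rewrite tr_mxcol mul_mxrow_mxcol.
rewrite -(big_enum_val (fun f => (component R k f)^T *m component R k f)) /=.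
apply: eq_big => [f|f _]; [exact: mem_tris_at_i|exact: gram_component].
Qed.

Lemma gram_unitv :
  \sum_(b < N * nV) (unitv R (blk_time b) (blk_vtx b))^T^T
                      *m (unitv R (blk_time b) (blk_vtx b))^T = 1%:M.
Proof.
rewrite mx1_sum_delta; apply: eq_bigr => b _.
rewrite trmxK trmx_delta mul_delta_mx /blk_time /blk_vtx -surjective_pairing.
by rewrite mxtens_unindexK.
Qed.

Lemma gram_opP : (opP N M)^T *m opP N M = 1%:M.
Proof.
rewrite tr_mxcol mul_mxrow_mxcol.
under eq_bigr => b _ do
  rewrite !(tr_diag3, tr_diag2, mul_diag3, mul_diag2).
by rewrite !(sum_diag3, sum_diag2) gram_unitv !gram_P_i !(diag3_1, diag2_1).
Qed.

End Operators.

Unset Implicit Arguments.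

Theorem proposition4p4 (R : realType) (N nV nT : nat) (M : mesh R nV nT)
    (hN : (0 < N)%N) :
  (forall v : 'I_nV, dim_blk M v = (2 + 6 * #|tris_at M v|)%N) /\
  opT N M = opP N M *m opD N M /\
  is_diag_mx (opD N M) /\
  exists e : dim_cod N M = dim_dom N nV nT,
    let P := castmx (e, erefl) (opP N M) in
    let T := castmx (e, erefl) (opT N M) in
    is_perm_mx P /\
    opD N M \in unitmx /\
    T \in unitmx /\
    invmx T = invmx (opD N M) *m P^T.
Proof.
split; first exact: dim_blkE.
split; first exact: opT_factor.
split; first exact: opD_is_diag.
have [e permP] := unit_rows_perm (@unit_rows_opP R N nV nT M) (gram_opP N M).
exists e => P T; have [uT invT] := perm_mul_unit_inv permP (opD_unit N M).
by rewrite /T /P opT_factor opD_unit uT invT.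
Qed.
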